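(* Let $W_n$ be the wheel on $n+1$ vertices. Then $src^\ell(W_n)=1$ if $n=3$; $src^\ell(W_n)=2$ if $n\in\{4,5,6\}$; and $src^\ell(W_n)=3$ if $n\in\{7,8,9\}$. For $n\ge 10$, \[\Big\lceil\frac{n}{3}\Big\rceil\le src^\ell(W_n)\le\begin{cases}\lceil\frac{4n-3}{9}\rceil, & n\equiv 0\pmod 3,\\ \lceil\frac{4n-1}{9}\rceil, & n\equiv 1\pmod 3,\\ \lceil\frac{4n+1}{9}\rceil, & n\equiv 2\pmod 3.\end{cases}\]
   Context: The wheel $W_n$ ($n\ge 3$) is obtained from the cycle $C_n$ by adding a new vertex adjacent to all vertices of the cycle. An edge-coloured path is rainbow if all its edges have distinct colours; a geodesic is a shortest path between its endpoints. An (not necessarily proper) edge-colouring of a connected graph is strongly rainbow connected if any two vertices are joined by a rainbow geodesic. An $r$-edge-list assignment of $G$ assigns to each edge $e$ a set $L(e)\subset\mathbb N$ with $|L(e)|\ge r$; an $L$-edge-colouring is an edge-colouring $c$ with $c(e)\in L(e)$ for all $e$. $src^\ell(G)$ is the minimum integer $r$ such that for every $r$-edge-list assignment $L$ of $G$ there exists a strongly rainbow connected $L$-edge-colouring of $G$. *)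

(* Defs.v *)
From mathcomp Require Import all_boot all_order all_algebra.
From mathcomp Require Import boolp classical_sets cardinality.

Set Implicit Arguments.
Unset Strict Implicit.
Unset Printing Implicit Defensive.

(* A simple graph is a symmetric irreflexive relation e on a finType T; its
   edges are the unordered pairs [set x; y] with e x y. *)
Section RainbowConnection.
Variables (T : finType) (e : rel T).

Definition edges : {set {set T}} :=
  [set [set x; y]%SET | x in T, y in T & e x y]%SET.

Definition is_path (x y : T) (p : seq T) : Prop :=
  [/\ path e x p, uniq (x :: p) & last x p = y].

Definition is_geodesic (x y : T) (p : seq T) : Prop :=
  is_path x y p /\ forall q, is_path x y q -> size p <= size q.

Definition path_edges (x : T) (p : seq T) : seq {set T} :=
  pairmap (fun a b => [set a; b]%SET) x p.

(* Colourings and list assignments are total functions on {set T}, of which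
   only the values on edges e are ever used. *)
Definition rainbow (c : {set T} -> nat) (x : T) (p : seq T) : bool :=
  uniq [seq c E | E <- path_edges x p].

Definition strongly_rainbow_connected (c : {set T} -> nat) : Prop :=
  forall x y : T, exists2 p : seq T, is_geodesic x y p & rainbow c x p.

(* The lists may be infinite. *)
Definition edge_list_assignment (r : nat) (L : {set T} -> set nat) : Prop :=
  forall E, E \in edges -> (`I_r #<= L E)%card.

Definition list_colouring (L : {set T} -> set nat) (c : {set T} -> nat) : Prop :=
  forall E, E \in edges -> L E (c E).

Definition list_src_at (r : nat) : Prop :=
  forall L, edge_list_assignment r L ->
    exists2 c, list_colouring L c & strongly_rainbow_connected c.

(* src^l(e) = r *)
Definition is_list_src (r : nat) : Prop :=
  list_src_at r /\ forall r', list_src_at r' -> r <= r'.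

End RainbowConnection.

Definition cycle_graph (n : nat) : rel 'I_n :=
  fun i j => (ordS i == j) || (ordS j == i).

Definition cone (T : eqType) (e : rel T) : rel (option T) :=
  fun u v => match u, v with
             | Some x, Some y => e x y
             | None, None => false
             | _, _ => true
             end.

Definition wheel (n : nat) : rel (option 'I_n) := cone (@cycle_graph n).
Arguments wheel n : clear implicits.

Lemma wheel_sym n : symmetric (wheel n).
Proof. by case=> [i|] [j|] //=; rewrite /cycle_graph orbC. Qed.

Lemma wheel_irr n : 1 < n -> irreflexive (wheel n).
Proof.
move=> n1 [i|] //=; rewrite /cycle_graph orbb; apply/negbTE/eqP => /(congr1 val) /=.
have [ni|ni] := eqVneq i.+1 n.
  by rewrite ni modnn => i0; move: n1; rewrite -ni -i0.
by rewrite modn_small; [move/eqP; rewrite eqn_leq ltnn | rewrite ltn_neqAle ni ltn_ord].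
Qed.

(* Main.v *)
(** Rim vertices at cyclic distance at least 3 are joined by a single geodesic, through the hub,
    so their spokes must have distinct colours; if the rim is properly coloured this is also
    sufficient. A colour class of spokes thus lies in three consecutive vertices, whence
    [n <= 3 r], and the upper bounds are bounds on the choice number of the complement of the
    square of [C_n].

    For [n >= 10] this complement is contained in the complete multipartite graph with [k = n %/ 3]
    parts of size 3 and [s = n %% 3] parts of size 1, which is [l]-choosable as soon as
    [k + s <= l] and [4 k + 2 s <= 3 l + 1] (Kierstead for [s = 0], Ohba in general). By Hall's
    theorem one may assume that there are fewer colours than vertices, and by induction that no
    colour is common to a whole part. Let [b p] be the largest intersection of two lists in the
    part [p], so that at least [k + s] and at most [3 b p] colours occur twice in [p]. A set [M]
    of [m] parts is chosen with [3 b p + 1 >= k + s + m] on [M] and [3 b p < k + s + m] off [M].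
    In each part of [M] two vertices with a common colour are merged, greedily along largest
    intersections with distinct representatives, then along arbitrary intersections for the few
    remaining parts. Hall's condition holds for the resulting vertices.

    For [n] in [{7, 8, 9}] the Alon-Tarsi theorem applies, and for [n] in [{4, 5, 6}] a greedy
    colouring does. *)
Require Import Defs.
From mathcomp Require Import boolp classical_sets functions cardinality.
From mathcomp Require Import all_boot all_order all_algebra zify lra.

Set Implicit Arguments.
Unset Strict Implicit.
Unset Printing Implicit Defensive.

Import GRing.Theory Num.Theory.

(** * Hall's theorem and transversals *)

Section Hall.
Variables (J C : finType) (c0 : C).

Lemma bigcup_setD (S : J -> {set C}) (B : {set J}) (U : {set C}) :
  \bigcup_(j in B) (S j :\: U) = (\bigcup_(j in B) S j) :\: U.
Proof.
apply/setP=> c; rewrite inE; apply/bigcupP/andP => [[j Bj /setDP[Sc ->]]|[nUc /bigcupP[j Bj Sc]]].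
  by split=> //; apply/bigcupP; exists j.
by exists j => //; rewrite inE nUc.
Qed.

(** Induction on [#|D|]. If some nonempty proper subset [A] is tight, [A] is matched inside its
    union and the rest outside it; otherwise [j0] may take any of its colours, the slack absorbing
    the loss of that colour. *)
Theorem Hall_marriage (S : J -> {set C}) (D : {set J}) :
    (forall A : {set J}, A \subset D -> #|A| <= #|\bigcup_(j in A) S j|) ->
  exists2 f : J -> C, {in D, forall j, f j \in S j} & {in D &, injective f}.
Proof.
have [m] := ubnP #|D|; elim: m => // m IHm in S D * => leDm hallD.
have [->|[j0 Dj0]] := set_0Vmem D.
  by exists (fun=> c0) => [j|j k]; rewrite inE.
have [[A /and4P[sAD ltAD A0 tightA]]|slack] :=
  altP (@existsP _ (fun A : {set J} => [&& A \subset D, #|A| < #|D|, A != set0 &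
                       #|\bigcup_(j in A) S j| == #|A|])).
- set U := \bigcup_(j in A) S j in tightA.
  have [||f1 f1S f1I] := IHm S A; first by lia.
    by move=> B sBA; apply: hallD; apply: subset_trans sBA sAD.
  have [||f2 f2S f2I] := IHm (fun j => S j :\: U) (D :\: A).
  + rewrite cardsD (setIidPr sAD); move: A0; rewrite -card_gt0; lia.
  + move=> B; rewrite subsetD => /andP[sBD dBA].
    have -> : \bigcup_(j in B) (S j :\: U) = (\bigcup_(j in A :|: B) S j) :\: U.
      rewrite bigcup_setU setDUl setDv set0U.
      by rewrite bigcup_setD.
    have /hallD : A :|: B \subset D by rewrite subUset sAD.
    rewrite cardsU disjoint_setI0 1?disjoint_sym // cards0 subn0.
    have sU : U \subset \bigcup_(j in A :|: B) S j by rewrite bigcup_setU subsetUl.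
    by rewrite cardsD (setIidPr sU) (eqP tightA); lia.
  exists (fun j => if j \in A then f1 j else f2 j) => [j Dj|j k Dj Dk].
    case: ifPn => jA; first exact: f1S.
    by have /setDP[] : f2 j \in S j :\: U by apply: f2S; rewrite inE jA.
  have f2U i : i \in D -> i \notin A -> f2 i \notin U.
    by move=> Di iA; have /setDP[] : f2 i \in S i :\: U by apply: f2S; rewrite inE iA.
  have f1U i : i \in A -> f1 i \in U.
    by move=> iA; apply/bigcupP; exists i => //; apply: f1S.
  case: ifPn => jA; case: ifPn => kA.
  + exact: f1I.
  + by move=> e; move: (f2U k Dk kA); rewrite -e f1U.
  + by move=> e; move: (f2U j Dj jA); rewrite e f1U.
  + by apply: f2I; rewrite inE ?jA ?kA.
have /card_gt0P[c Sc] : 0 < #|S j0|.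
  have := hallD [set j0]; rewrite cards1 big_set1; apply.
  by rewrite sub1set.
have [||f fS fI] := IHm (fun j => S j :\ c) (D :\ j0).
- by have := cardsD1 j0 D; rewrite Dj0; lia.
- move=> B /subsetD1P[sBD j0B].
  have [->|B0] := eqVneq B set0; first by rewrite cards0.
  rewrite bigcup_setD.
  have ltBD : #|B| < #|D|.
    apply: proper_card; rewrite properE sBD; apply/subsetPn.
    by exists j0.
  move/existsPn: slack => /(_ B); rewrite sBD ltBD B0 /= => neq.
  have := hallD B sBD; have := cardsD1 c (\bigcup_(j in B) S j).
  by case: (c \in _); lia.
exists (fun j => if j == j0 then c else f j) => [j Dj|j k Dj Dk].
  case: eqVneq => [-> //|nj].
  by have /setDP[] : f j \in S j :\ c by apply: fS; rewrite !inE nj.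
have fc i : i \in D -> i != j0 -> f i != c.
  by move=> Di ni; have : f i \in S i :\ c by [apply: fS; rewrite !inE ni]; rewrite !inE => /andP[].
case: eqVneq => [->|nj]; case: eqVneq => [->|nk] //.
- by move=> e; move: (fc k Dk nk); rewrite -e eqxx.
- by move=> e; move: (fc j Dj nj); rewrite e eqxx.
- by apply: fI; rewrite !inE ?nj ?nk.
Qed.

(** Greedy: fewer than [#|M|] colours are in use when the next element of [M] is served. *)
Lemma extend_transversal (N : J -> {set C}) (G M : {set J}) (f : J -> C) :
    G \subset M -> {in G &, injective f} -> {in M, forall p, #|M| <= #|N p|} ->
  exists g : J -> C, [/\ {in G, g =1 f}, {in M :\: G, forall p, g p \in N p}
    & {in M &, injective g}].
Proof.
have [m] := ubnP #|M :\: G|; elim: m => // m IHm in G f * => leMm sGM fI bigN.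
have [/eqP|[p]] := set_0Vmem (M :\: G).
  rewrite setD_eq0 => sMG; have eMG : M = G by apply/eqP; rewrite eqEsubset sMG.
  by exists f; split=> //; rewrite eMG // => p; rewrite setDv inE.
case/setDP=> Mp nGp.
have [c Nc cG] : exists2 c, c \in N p & c \notin f @: G.
  apply/subsetPn/negP => /subset_leq_card; rewrite card_in_imset // => leNG.
  have : #|G| < #|M|.
    by apply: proper_card; rewrite properE sGM; apply/subsetPn; exists p.
  by have := bigN p Mp; lia.
pose f' q := if q == p then c else f q.
have f'G : {in G, f' =1 f}.
  by move=> q Gq; rewrite /f'; case: eqP Gq nGp => // -> ->.
have [||||g [gf gN gI]] := IHm (p |: G) f'.
- rewrite setUC setDUr; have := cardsD1 p (M :\: G); rewrite !inE nGp Mp.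
  have -> : (M :\: G) :&: (M :\ p) = (M :\: G) :\ p.
    by apply/setP=> q; rewrite !inE; case: (q \in G); case: (q \in M); case: (q == p).
  lia.
- by rewrite subUset sub1set Mp.
- have f'p : f' p = c by rewrite /f' eqxx.
  move=> u v /setU1P[->|Gu] /setU1P[->|Gv] //; rewrite ?f'p ?f'G //.
  + by move=> e; case/negP: cG; rewrite e imset_f.
  + by move=> e; case/negP: cG; rewrite -e imset_f.
  + exact: fI.
- exact: bigN.
exists g; split=> // q.
  by move=> Gq; rewrite gf ?f'G // inE Gq orbT.
case/setDP=> Mq nGq; have [->|nqp] := eqVneq q p.
  by rewrite gf ?setU11 // /f' eqxx.
by apply: gN; rewrite !inE negb_or nqp nGq.
Qed.

(** Take [G] inclusion-maximal with distinct representatives in [B]; for [p] in [M :\: G], every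
    colour of [B p] is then already used on [G]. *)
Lemma maximal_transversal (B : J -> {set C}) (M : {set J}) :
  exists G : {set J}, exists f : J -> C,
    [/\ G \subset M, {in G &, injective f}, {in G, forall p, f p \in B p}
      & {in M :\: G, forall p, #|B p| <= #|G|}].
Proof.
pose ok (G : {set J}) := (G \subset M) &&
  [exists f : {ffun J -> C}, [forall p in G, f p \in B p] &&
     [forall p in G, forall q in G, (f p == f q) ==> (p == q)]].
have [|G /maxsetP[/andP[sGM /existsP[f /andP[/forall_inP fB fI]]] maxG]] := @ex_maxset _ ok.
  exists set0; rewrite /ok sub0set; apply/existsP; exists [ffun=> c0].
  by apply/andP; split; apply/forall_inP => p; rewrite inE.
have {}fI : {in G &, injective f}.
  by move=> p q Gp Gq /eqP e; apply/eqP; move/forall_inP/(_ p Gp)/forall_inP/(_ q Gq): fI; rewrite e.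
exists G, f; split=> // p /setDP[Mp nGp].
rewrite -(card_in_imset fI); apply: subset_leq_card; apply/negPn/negP => /subsetPn[c Bc cG].
suff /maxG e : ok (p |: G) by case/negP: nGp; rewrite -e ?setU11 ?subsetUr.
rewrite /ok subUset sub1set Mp sGM /=; apply/existsP.
exists [ffun q => if q == p then c else f q].
have ffp : [ffun q => if q == p then c else f q] p = c by rewrite ffunE eqxx.
have ffG q : q \in G -> [ffun q => if q == p then c else f q] q = f q.
  by rewrite ffunE; case: eqP => // ->; rewrite (negPf nGp).
apply/andP; split.
  by apply/forall_inP => q /setU1P[->|Gq]; rewrite ?ffp ?ffG //; apply: fB.
apply/forall_inP => q Hq; apply/forall_inP => r Hr; apply/implyP => /eqP.
case/setU1P: Hq => [->|Gq]; case/setU1P: Hr => [->|Gr] //; rewrite ?ffp ?ffG //.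
- by move=> e; case/negP: cG; rewrite e imset_f.
- by move=> e; case/negP: cG; rewrite -e imset_f.
- by move/fI => ->.
Qed.

End Hall.

Lemma set3_of_pair (T : finType) (F : {set T}) (x y : T) :
    #|F| = 3 -> x \in F -> y \in F -> x != y ->
  exists z, [/\ F = [set x; y; z], z != x & z != y].
Proof.
move=> F3 Fx Fy nxy; have := cardsD1 x F; rewrite F3 Fx.
have := cardsD1 y (F :\ x); rewrite !inE Fy eq_sym nxy /= => e1 e2.
have /eqP/cards1P[z ez] : #|F :\ x :\ y| = 1 by lia.
have : z \in F :\ x :\ y by rewrite ez set11.
rewrite !inE => /and3P[nzy nzx Fz]; exists z; split=> //.
apply/eqP; rewrite eq_sym eqEcard !subUset !sub1set Fx Fy Fz F3 /=.
by rewrite cardsU cards2 cards1 nxy disjoint_setI0 ?cards0 // disjoint_sym disjoints1 !inE negb_or nzx.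
Qed.

(** No colour is counted three times on the left, and the second set on the right collects those
    counted twice. *)
Lemma card_in_two_of_three (C : finType) (X Y Z : {set C}) : X :&: Y :&: Z = set0 ->
  #|X| + #|Y| + #|Z| = #|X :|: Y :|: Z| + #|X :&: Y :|: (X :&: Z :|: Y :&: Z)|.
Proof.
move=> XYZ; rewrite -setIUl.
have := cardsUI (X :|: Y) Z; have := cardsUI X Y; have := cardsUI (X :&: Y) ((X :|: Y) :&: Z).
have -> : X :&: Y :&: ((X :|: Y) :&: Z) = set0.
  by apply/setP=> c; move/setP/(_ c): XYZ; rewrite !inE; case: (c \in X); case: (c \in Y); case: (c \in Z).
rewrite cards0; lia.
Qed.

Lemma interpolate_subset (T : finType) (A B : {set T}) m :
  A \subset B -> #|A| <= m <= #|B| -> exists M : {set T}, [/\ A \subset M, M \subset B & #|M| = m].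
Proof.
move=> sAB; elim: m => [|m IHm] /andP[leA leB].
  by exists A; split=> //; lia.
case: (ltnP m #|A|) => [ltmA|leAm]; first by exists A; split=> //; lia.
have [|M [sAM sMB cM]] := IHm; first by lia.
have [x Bx nMx] : exists2 x, x \in B & x \notin M.
  by apply/subsetPn/negP => /subset_leq_card; lia.
exists (x |: M); split; first exact: subset_trans sAM (subsetUr _ _).
  by rewrite subUset sub1set Bx.
by rewrite cardsU1 nMx cM.
Qed.

(* [M] is squeezed between [{p | K + m <= 3 b p}] and [{p | K + m <= 3 b p + 1}], where [m] is
   the least integer such that the first of these sets has at most [m] elements. *)
Lemma threshold_subset (P : finType) (Q : {set P}) (b : P -> nat) (K : nat) :
  exists M : {set P}, [/\ M \subset Q, {in M, forall p, K + #|M| <= 3 * b p + 1}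
    & {in Q :\: M, forall p, 3 * b p < K + #|M|}].
Proof.
pose S m := [set p in Q | K + m <= 3 * b p].
have ex : exists m, #|S m| <= m.
  by exists #|Q|; apply: subset_leq_card; apply/subsetP=> p; rewrite inE => /andP[].
case: (ex_minnP ex) => m leSm minm.
(* For [m > 0], minimality of [m] gives [S m.-1] at least [m] elements; for [m = 0], [S 0] is
   already empty. *)
pose S' := if m is m'.+1 then S m' else S m.
have [||M [sSM sMS cM]] := @interpolate_subset _ (S m) S' m.
- rewrite /S'; case: (m) => // m'; apply/subsetP=> p; rewrite !inE; lia.
- rewrite leSm /= /S'; case: m leSm minm {S'} => // m' _ minm.
  by rewrite ltnNge; apply/negP => /minm; rewrite ltnn.
exists M; rewrite cM; split.
- apply: subset_trans sMS _; rewrite /S'; apply/subsetP=> p.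
  by case: (m) => [|m']; rewrite inE => /andP[].
- move=> p /(subsetP sMS); rewrite /S'; case: (m) => [|m']; rewrite inE => /andP[_]; lia.
- move=> p /setDP[Qp nMp]; rewrite ltnNge; apply: contra nMp => le.
  by apply: (subsetP sSM); rewrite inE Qp.
Qed.

(** * Complete multipartite graphs with parts of size 1 and 3 *)

Section CompleteMultipartite.
Variables (T P C : finType) (part : T -> P) (c0 : C).
Implicit Types (V : {set T}) (L : T -> {set C}).

Definition multipartite_colourable V L := exists2 c : T -> C,
  {in V, forall v, c v \in L v} & {in V &, forall u v, c u = c v -> part u = part v}.

(** On a maximal set [A] violating Hall's condition the colours come from [small]; by maximality,
    Hall's theorem matches the remaining vertices to distinct colours that occur in no list of
    [A]. *)
Lemma small_pot V (l : nat) :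
    (forall L, {in V, forall v, l <= #|L v|} -> #|\bigcup_(v in V) L v| < #|V| ->
       multipartite_colourable V L) ->
  forall L, {in V, forall v, l <= #|L v|} -> multipartite_colourable V L.
Proof.
move=> small L bigL.
pose bad (A : {set T}) := (A \subset V) && (#|\bigcup_(v in A) L v| < #|A|).
have [/existsP/ex_maxset[A /maxsetP[/andP[sAV badA] maxA]]|/existsPn good] :=
  boolP [exists A, bad A]; last first.
  have [A sAV|c cL cI] := Hall_marriage c0 (S := L) (D := V).
    by have := good A; rewrite /bad sAV -leqNgt.
  by exists c => // u v Vu Vv /cI ->.
have [a Aa] : exists a, a \in A by apply/card_gt0P; lia.
(* Vertices outside [A] borrow the list of [a], so that all colours lie in the union over [A], which
   has fewer than [#|A|] elements. *)
have [||c cL cI] := small (fun v => if v \in A then L v else L a).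
- by move=> v Vv; case: ifP => _; apply: bigL => //; apply: (subsetP sAV).
- apply: leq_ltn_trans (leq_trans badA (subset_leq_card sAV)).
  apply: subset_leq_card; apply/bigcupsP => v Vv.
  by case: ifP => Av; [apply: (bigcup_sup v) | apply: (bigcup_sup a)].
have cA v : v \in V -> c v \in \bigcup_(v in A) L v.
  by move=> /cL; case: ifP => Av Lc; apply/bigcupP; [exists v | exists a].
have [B sBD|d dL dI] := Hall_marriage c0 (S := fun v => L v :\: \bigcup_(v in A) L v) (D := V :\: A).
  have [->|B0] := eqVneq B set0; first by rewrite cards0.
  move: sBD; rewrite subsetD => /andP[sBV dBA].
  have notbad : ~~ bad (A :|: B).
    apply/negP => /maxA /(_ (subsetUl _ _))/setUidPl sBA.
    by case/negP: B0; rewrite -(setIidPl sBA) disjoint_setI0.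
  rewrite bigcup_setD cardsD.
  move: notbad; rewrite /bad subUset sAV sBV /= -leqNgt bigcup_setU.
  have := cardsUI A B; rewrite (disjoint_setI0 (A := A)) 1?disjoint_sym // cards0.
  have := cardsUI (\bigcup_(i in A) L i) (\bigcup_(i in B) L i).
  rewrite [_ :&: \bigcup_(i in A) _]setIC; move: badA.
  have := subset_leq_card (subsetIr (\bigcup_(i in A) L i) (\bigcup_(i in B) L i)).
  lia.
have dA v : v \in V -> v \notin A -> d v \notin \bigcup_(v in A) L v.
  by move=> Vv nAv; have /dL/setDP[] : v \in V :\: A by rewrite inE nAv.
exists (fun v => if v \in A then c v else d v) => [v Vv|u v Vu Vv].
  case: ifPn => [Av|nAv]; first by have := cL v Vv; rewrite Av.
  by have /dL/setDP[] : v \in V :\: A by rewrite inE nAv.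
case: ifPn => Au; case: ifPn => Av.
- exact: cI.
- by move=> e; have := dA v Vv Av; rewrite -e cA.
- by move=> e; have := dA u Vu Au; rewrite e cA.
- by move/dI => ->; rewrite // inE ?Au ?Av.
Qed.

End CompleteMultipartite.

Section Ohba.
Variables (T P C : finType) (part : T -> P) (c0 : C).
Implicit Types (V A : {set T}) (L : T -> {set C}).

Definition fibre V p := [set v in V | part v == p].
Definition parts_of_size V j := [set p | #|fibre V p| == j].
Definition parts_1_or_3 V := forall p, #|fibre V p| \in [:: 0; 1; 3].

Lemma card_fibrewise_le V A (g : P -> nat) : parts_1_or_3 V -> A \subset V ->
    {in parts_of_size V 3, forall p, #|A :&: fibre V p| <= g p} ->
  #|A| <= #|parts_of_size V 1| + \sum_(p in parts_of_size V 3) g p.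
Proof.
move=> V13 sAV gA.
have -> : #|A| = \sum_p #|A :&: fibre V p|.
  rewrite -sum1_card (partition_big part predT) //=; apply: eq_bigr => p _.
  rewrite -sum1_card; apply: eq_bigl => v; rewrite !inE.
  by case Av: (v \in A) => //=; rewrite (subsetP sAV).
rewrite -sum1_card addnC [X in _ <= X + _]big_mkcond [X in _ <= _ + X]big_mkcond -big_split /=.
apply: leq_sum => p _; move: (gA p) (V13 p) (subset_leq_card (subsetIr A (fibre V p))).
rewrite !inE => gp /or3P[] /eqP e; rewrite e /= in gp *; rewrite ?addn0 //.
by move=> _; apply: gp.
Qed.

Lemma card_parts_1_or_3 V : parts_1_or_3 V ->
  #|V| = #|parts_of_size V 1| + 3 * #|parts_of_size V 3|.
Proof.
move=> V13.
have -> : #|V| = \sum_p #|fibre V p|.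
  rewrite -sum1_card (partition_big part predT) //=; apply: eq_bigr => p _.
  by rewrite -sum1_card; apply: eq_bigl => v; rewrite !inE.
rewrite -sum1_card mulnC -sum_nat_const.
rewrite [X in _ = X + _]big_mkcond [X in _ = _ + X]big_mkcond -big_split /=.
by apply: eq_bigr => p _; move: (V13 p); rewrite !inE => /or3P[] /eqP->.
Qed.

Lemma largest_intersection L (F : {set T}) : #|F| = 3 -> exists t : T * T * T,
  let: (x, y, z) := t in
  [/\ F = [set x; y; z], [/\ x != y, z != x & z != y],
      #|L x :&: L z| <= #|L x :&: L y| & #|L y :&: L z| <= #|L x :&: L y|].
Proof.
move=> F3; have : 1 < #|F| by rewrite F3.
case/card_gt1P=> x [y [Fx Fy nxy]].
have [z [eF nzx nzy]] := set3_of_pair F3 Fx Fy nxy.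
have [h1|h1] := leqP #|L x :&: L z| #|L x :&: L y|.
  have [h2|h2] := leqP #|L y :&: L z| #|L x :&: L y|; first by exists (x, y, z).
  exists (y, z, x); rewrite eF [L y :&: L x]setIC [L z :&: L x]setIC.
  split; [by rewrite -setUA setUC | by split; rewrite // eq_sym | lia | lia].
have [h2|h2] := leqP #|L y :&: L z| #|L x :&: L z|.
  exists (x, z, y); rewrite eF [L z :&: L y]setIC.
  split; [by rewrite setUAC | by split; rewrite // eq_sym | lia | lia].
exists (y, z, x); rewrite eF [L y :&: L x]setIC [L z :&: L x]setIC.
split; [by rewrite -setUA setUC | by split; rewrite // eq_sym | lia | lia].
Qed.

Section Merging.
Variables (V : {set T}) (L : T -> {set C}) (l : nat).
Let Q := parts_of_size V 3.
Let k := #|Q|.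
Let s := #|parts_of_size V 1|.
Hypothesis V13 : parts_1_or_3 V.
Hypothesis l_ge_parts : k + s <= l.
Hypothesis l_ge : 4 * k + 2 * s <= 3 * l + 1.
Hypothesis bigL : {in V, forall v, l <= #|L v|}.
Hypothesis pot : #|\bigcup_(v in V) L v| < #|V|.
Hypothesis no_common : {in Q, forall p, \bigcap_(v in fibre V p) L v = set0}.

Lemma merging_colourable : multipartite_colourable part V L.
Proof.
have [V0|[v0 Vv0]] := set_0Vmem V.
  by exists (fun=> c0); [move=> v | move=> u v]; rewrite V0 inE.
have cV := card_parts_1_or_3 V13; rewrite -/k -/s in cV.
have inV p v : v \in fibre V p -> v \in V by rewrite inE => /andP[].
have inP p v : v \in fibre V p -> part v = p by rewrite inE => /andP[_ /eqP].
have Q3 p : p \in Q -> #|fibre V p| = 3 by rewrite inE => /eqP.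
have triples : forall p, exists t : T * T * T, p \in Q -> let: (x, y, z) := t in
    [/\ fibre V p = [set x; y; z], [/\ x != y, z != x & z != y],
      #|L x :&: L z| <= #|L x :&: L y| & #|L y :&: L z| <= #|L x :&: L y|].
  move=> p; case: (boolP (p \in Q)) => [Qp|_]; last by exists (v0, v0, v0).
  by have [t ht] := largest_intersection L (Q3 p Qp); exists t.
have [t tP] := fin_all_exists triples.
(* In a part [p] of size 3, [B p] is a largest intersection, [N p] holds the colours of exactly two
   lists (none is in all three), and [W p] is the pot of the part. *)
pose B p := let: (x, y, z) := t p in L x :&: L y.
pose N p := let: (x, y, z) := t p in L x :&: L y :|: (L x :&: L z :|: L y :&: L z).
pose W p := \bigcup_(v in fibre V p) L v.
have N_W p : p \in Q -> 3 * l <= #|W p| + #|N p|.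
  move=> Qp; move: (tP p Qp) (no_common Qp); rewrite /W /N; case: (t p) => [[x y] z].
  case=> eF [nxy nzx nzy] _ _; rewrite eF.
  have [Fx Fy Fz] : [/\ x \in fibre V p, y \in fibre V p & z \in fibre V p].
    by rewrite eF !inE !eqxx !orbT.
  rewrite bigcup_setU bigcup_setU !big_set1 => com.
  have := @card_in_two_of_three _ (L x) (L y) (L z); rewrite -com => <-.
    by have := bigL (inV _ _ Fx); have := bigL (inV _ _ Fy); have := bigL (inV _ _ Fz); clear; lia.
  apply/setP=> c; apply/idP/bigcapP; last first.
    by move=> h; rewrite !inE !h // !inE !eqxx ?orbT.
  by rewrite !inE => /andP[/andP[cx cy] cz] v; rewrite !inE => /orP[/orP[]|] /eqP->.
have N_B p : p \in Q -> #|N p| <= 3 * #|B p|.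
  move=> Qp; move: (tP p Qp); rewrite /B /N; case: (t p) => [[x y] z] [_ _ h1 h2].
  have := leq_card_setU (L x :&: L y) (L x :&: L z :|: L y :&: L z).
  have := leq_card_setU (L x :&: L z) (L y :&: L z).
  by move=> [u1 _] [u2 _]; lia.
have B_max p u v : p \in Q -> u \in fibre V p -> v \in fibre V p -> u != v ->
    #|L u :&: L v| <= #|B p|.
  move=> Qp; move: (tP p Qp); rewrite /B; case: (t p) => [[x y] z] [-> _ h1 h2].
  rewrite !inE -!orbA => /or3P[] /eqP-> /or3P[] /eqP->; rewrite ?eqxx //.
  - by rewrite [L y :&: L x]setIC.
  - by rewrite [L z :&: L x]setIC.
  - by rewrite [L z :&: L y]setIC.
have W_pot p : #|W p| <= #|\bigcup_(v in V) L v|.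
  by apply: subset_leq_card; apply/bigcupsP => v /inV Vv; apply: (bigcup_sup v).
have [M [sMQ M_B nM_B]] := threshold_subset Q (fun p => #|B p|) (k + s).
have leMQ : #|M| <= k by apply: subset_leq_card.
have [G [f [sGM fI fB nG_B]]] := maximal_transversal c0 B M.
have [|g [gf gN gI]] := extend_transversal (N := N) sGM fI.
  (* [#|N p| >= 3 l - #|W p| >= 3 l + 1 - (3 k + s) >= k + s >= #|M|]. *)
  move=> p /(subsetP sMQ) Qp; have := N_W p Qp; have := W_pot p; move: pot l_ge leMQ cV; clear; lia.
(* A part of [M :\: G] has its largest intersection used up by [G], so [G] is large. *)
have defect : M :\: G = set0 \/ 3 * #|M :\: G| + s <= k + 1.
  have [->|[p Mp]] := set_0Vmem (M :\: G); [by left | right].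
  have /setDP[Mp' _] := Mp.
  have := nG_B p Mp; have := M_B p Mp'; have := cardsD M G.
  rewrite (setIidPr sGM); have := subset_leq_card sGM; lia.
(* In each part of [M] the pair [X], [Y] is identified; [g p] is a common colour. *)
have merges : forall p, exists t : T * T * T, p \in M -> let: (x, y, z) := t in
    [/\ fibre V p = [set x; y; z], [/\ x != y, z != x & z != y],
      g p \in L x :&: L y & p \in G -> #|L x :&: L y| = #|B p|].
  move=> p; case: (boolP (p \in M)) => [Mp|_]; last by exists (v0, v0, v0).
  have Qp := subsetP sMQ p Mp.
  case: (boolP (p \in G)) => Gp.
    exists (t p) => _; move: (gf p Gp) (tP p Qp) (fB p Gp).
    by rewrite /B; case: (t p) => [[x y] z] -> [-> ? _ _].
  have : g p \in N p by apply: gN; rewrite inE Gp.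
  move: (tP p Qp); rewrite /N; case: (t p) => [[x y] z] [eF [nxy nzx nzy] _ _].
  case/setUP=> [h|/setUP[] h].
  - by exists (x, y, z).
  - exists (x, z, y); split=> //; first by rewrite eF setUAC.
    by split; rewrite // eq_sym.
  - exists (y, z, x); split=> //; first by rewrite eF -setUA setUC.
    by split; rewrite // eq_sym.
have {merges} [m mP] := fin_all_exists merges.
pose X p := (m p).1.1; pose Y p := (m p).1.2; pose Z p := (m p).2.
have {}mP p : p \in M -> [/\ fibre V p = [set X p; Y p; Z p],
     [/\ X p != Y p, Z p != X p & Z p != Y p],
     g p \in L (X p) :&: L (Y p) & p \in G -> #|L (X p) :&: L (Y p)| = #|B p|].
  by move=> /mP; rewrite /X /Y /Z; case: (m p) => [[x y] z].
have XYZ p : p \in M -> [/\ X p \in fibre V p, Y p \in fibre V p & Z p \in fibre V p].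
  by case/mP=> -> _ _ _; rewrite !inE !eqxx !orbT.
have partX p : p \in M -> part (X p) = p by case/XYZ => /inP.
have partY p : p \in M -> part (Y p) = p by case/XYZ => _ /inP.
pose isX v := (part v \in M) && (v == X (part v)).
pose isY v := (part v \in M) && (v == Y (part v)).
(* [D] drops [Y p] from each merged pair; in [L'] the remaining [X p] keeps only the colours common
   to both. *)
pose D := V :\: Y @: M.
pose L' v := if isX v then L v :&: L (Y (part v)) else L v.
have isXX p : p \in M -> isX (X p) by move=> Mp; rewrite /isX partX // Mp eqxx.
have inD v : (v \in D) = (v \in V) && ~~ isY v.
  rewrite inE andbC; congr (_ && ~~ _); apply/imsetP/andP => [[p Mp ->]|[Mv /eqP vY]].
    by rewrite partY // Mp.
  by exists (part v).
have cD : #|D| + #|M| = #|V|.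
  rewrite -(cardsID (Y @: M) V) addnC; congr (_ + _).
  rewrite (setIidPr _); last by apply/subsetP=> _ /imsetP[p Mp ->]; case/XYZ: Mp => _ /inV.
  by rewrite card_in_imset // => p q Mp Mq e; rewrite -(partY p) // -(partY q) // e.
have [A sAD|c cL cI] := Hall_marriage c0 (S := L') (D := D); last first.
  (* Each dropped [Y p] takes the colour of [X p], which lies in the same part. *)
  pose r v := if isY v then X (part v) else v.
  have part_r v : part (r v) = part v.
    by rewrite /r; case: ifP => // /andP[Mv _]; rewrite partX.
  have Dr v : v \in V -> r v \in D.
    move=> Vv; rewrite /r; case: ifPn => [/andP[Mv _]|nYv]; last by rewrite inD Vv.
    rewrite inD; case: (XYZ _ Mv) => /inV-> _ _; rewrite /isY partX // Mv /=.
    by case: (mP _ Mv) => _ [].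
  exists (fun v => c (r v)) => [v Vv|u v Vu Vv].
    have := cL _ (Dr v Vv); rewrite /L' /r.
    case: ifPn => [/andP[Mv /eqP vY]|_]; last by case: ifP => // _ /setIP[].
    by rewrite isXX // partX // => /setIP[_]; rewrite -vY.
  by move/cI=> e; rewrite -part_r e ?part_r // Dr.
(* It remains to verify Hall's condition for [A], according to the largest number of members
   of [A] in an unmerged part (3, 2, or at most 1). *)
have sAV : A \subset V := subset_trans sAD (subsetDl _ _).
pose U := \bigcup_(v in A) L' v.
have leU (S : {set C}) : S \subset U -> #|S| <= #|U| by apply: subset_leq_card.
have L'U v : v \in A -> L' v \subset U by move=> Av; apply: (bigcup_sup v).
have LU v : v \in A -> ~~ isX v -> L v \subset U.
  by move=> Av nXv; have := L'U v Av; rewrite /L' (negPf nXv).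
have LUp p v : p \in Q :\: M -> v \in A :&: fibre V p -> L v \subset U.
  case/setDP=> _ nMp /setIP[Av /inP vp]; apply: LU => //.
  by rewrite /isX vp (negPf nMp).
have [[p /andP[Qp full]]|/existsPn nofull] := 
  altP (@existsP P (fun p => (p \in Q :\: M) && (fibre V p \subset A))).
  (* [#|W p| >= 3 l - 3 #|B p| > 3 l - (k + s + #|M|)], hence [#|U| >= 3 k + s - #|M| = #|D|]. *)
  have /leU : W p \subset U.
    by apply/bigcupsP=> v Fv; apply: (LUp p) => //; rewrite inE Fv (subsetP full).
  have := nM_B p Qp; case/setDP: Qp => Qp _; have := N_W p Qp; have := N_B p Qp.
  have := subset_leq_card sAD; move: cD cV l_ge; rewrite -/U; clear; lia.
have le2 p : p \in Q -> #|A :&: fibre V p| <= 2.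
  move=> Qp; have : A :&: fibre V p \proper fibre V p.
    rewrite properE subsetIr subsetI subxx andbT /=.
    case: (boolP (p \in M)) => [Mp|nMp]; last by have := nofull p; rewrite inE nMp Qp.
    apply/subsetPn; exists (Y p); first by case: (XYZ p Mp).
    by apply/negP => /(subsetP sAD); rewrite inD /isY partY // Mp eqxx /= andbF.
  by move/proper_card; rewrite Q3.
have [[p /andP[Qp two]]|/existsPn notwo] :=
  altP (@existsP P (fun p => (p \in Q :\: M) && (1 < #|A :&: fibre V p|))).
  (* Two lists of an unmerged part give [#|U| >= 2 l - #|B p|] with [3 #|B p| < 2 k + s], while
     [#|A| <= 2 k + s]. *)
  case/card_gt1P: two => u [v [Fu Fv nuv]].
  have := card_fibrewise_le V13 sAV le2; rewrite sum_nat_const -/k -/s.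
  have /leU : L u :|: L v \subset U by rewrite subUset !(LUp p).
  have := nM_B p Qp; case/setDP: Qp => Qp _.
  move: Fu Fv => /setIP[_ Fu] /setIP[_ Fv].
  have := B_max p u v Qp Fu Fv nuv; have := cardsUI (L u) (L v).
  have := bigL (inV _ _ Fu); have := bigL (inV _ _ Fv); move: l_ge leMQ; rewrite -/U; clear; lia.
(* From here on, only the merged parts in [S] can contain two members of [A]. *)
pose S := [set p in M | (X p \in A) && (Z p \in A)].
have sSM : S \subset M by apply/subsetP=> p; rewrite inE => /andP[].
have cA : #|A| <= k + s + #|S|.
  have := @card_fibrewise_le V A (fun p => 1 + (p \in S)) V13 sAV.
  rewrite big_split /= sum_nat_const muln1 -/k -/s.
  have -> : \sum_(p in Q) (p \in S : nat) = #|S|.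
    rewrite -sum1_card -big_mkcondr /=; apply: eq_bigl => p.
    by apply: andb_idl => /(subsetP sSM)/(subsetP sMQ).
  move=> h; suff : #|A| <= s + (k + #|S|) by lia.
  apply: h => p Qp.
  case: (boolP (p \in S)) => [_|nSp]; first exact: le2.
  case: (boolP (p \in M)) => [Mp|nMp]; last first.
    by have := notwo p; rewrite inE nMp Qp /= -leqNgt addn0.
  rewrite leqNgt; apply/negP => /card_gt1P[u [v [/setIP[Au Fu] /setIP[Av Fv] nuv]]].
  have nY w : w \in A -> w != Y p.
    move/(subsetP sAD); rewrite inD => /andP[_]; apply: contra => /eqP->.
    by rewrite /isY partY // Mp eqxx.
  case/negP: nSp; rewrite inE Mp /=; have nYu := nY u Au; have nYv := nY v Av.
  move: nYu nYv Au Av nuv Fu Fv.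
  case: (mP p Mp) => -> _ _ _; rewrite !inE => /negPf-> /negPf->; rewrite !orbF.
  by move=> Au Av nuv /orP[] /eqP eu /orP[] /eqP ev; move: Au Av nuv; rewrite eu ev ?eqxx // => -> ->.
(* For empty [S], [#|A| <= k + s <= l], so one full list inside [U] suffices; if every member of [A]
   is some [X p], the distinct colours [g p] witness the bound. *)
have [S0|[p0 Sp0]] := set_0Vmem S.
  rewrite S0 cards0 addn0 in cA.
  case: (boolP [exists v in A, ~~ isX v]) => [/exists_inP[v Av nXv]|].
    apply: leq_trans cA (leq_trans l_ge_parts _).
    exact: leq_trans (bigL (subsetP sAV v Av)) (leU _ (LU v Av nXv)).
  rewrite negb_exists => /forallP allX.
  have {}allX v : v \in A -> isX v by move=> Av; have := allX v; rewrite Av negbK.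
  have gA : {in A &, injective (g \o part)}.
    move=> u v /allX/andP[Mu /eqP eu] /allX/andP[Mv /eqP ev] /= /gI e.
    by rewrite eu ev e.
  rewrite -(card_in_imset gA); apply: subset_leq_card; apply/subsetP=> _ /imsetP[v Av ->] /=.
  apply/bigcupP; exists v => //; have Xv := allX v Av; rewrite /L' Xv.
  by case/andP: Xv => Mv /eqP ev; case: (mP _ Mv) => _ _; rewrite -ev.
(* No colour is common to the whole part, so [L (Z p)] is disjoint from the merged list. *)
have lU p : p \in S -> l + #|L (X p) :&: L (Y p)| <= #|U|.
  rewrite inE => /and3P[Mp XA ZA]; have Qp := subsetP sMQ p Mp.
  have [_ _ FZ] := XYZ p Mp; have [eF [nXY nZX nZY] _ _] := mP p Mp.
  have nXZ : ~~ isX (Z p) by rewrite /isX (inP _ _ FZ) negb_and nZX orbT.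
  have /leU : L (Z p) :|: (L (X p) :&: L (Y p)) \subset U.
    rewrite subUset LU //; have := L'U _ XA.
    by rewrite /L' isXX // partX.
  have := cardsUI (L (Z p)) (L (X p) :&: L (Y p)).
  have -> : L (Z p) :&: (L (X p) :&: L (Y p)) = set0.
    rewrite -(no_common Qp) eF; apply/setP=> c; apply/idP/bigcapP; last first.
      by move=> h; rewrite !inE !h // !inE !eqxx ?orbT.
    by rewrite !inE => /and3P[cz cx cy] v; rewrite !inE => /orP[/orP[]|] /eqP->.
  by rewrite cards0 addn0 => -> h; apply: leq_trans h; rewrite leq_add2r bigL // (inV p).
apply: leq_trans cA _; rewrite -/U.
have leSM := subset_leq_card sSM.
(* If [S] is larger than [M :\: G] it meets [G], where the merged list is a largest intersection; if
   not, [defect] bounds [#|S|] so that [l] colours suffice. *)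
have [ltd|led] := ltnP #|M :\: G| #|S|.
  have [p Sp Gp] : exists2 p, p \in S & p \in G.
    have [p Sp np] : exists2 p, p \in S & p \notin M :\: G.
      by apply/subsetPn/negP => /subset_leq_card; lia.
    by exists p => //; move: np; rewrite inE (subsetP sSM) // andbT negbK.
  have := lU p Sp; have Mp := subsetP sSM p Sp; have := M_B p Mp.
  by case: (mP p Mp) => _ _ _ /(_ Gp) ->; move: l_ge leMQ leSM; clear; lia.
have := lU p0 Sp0; have : 0 < #|S| by apply/card_gt0P; exists p0.
by move: l_ge led; case: defect => [->|]; rewrite ?cards0; clear; lia.
Qed.

End Merging.

Theorem Ohba_choosable V L (l : nat) : parts_1_or_3 V ->
    #|parts_of_size V 3| + #|parts_of_size V 1| <= l ->
    4 * #|parts_of_size V 3| + 2 * #|parts_of_size V 1| <= 3 * l + 1 ->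
    {in V, forall v, l <= #|L v|} ->
  multipartite_colourable part V L.
Proof.
have [m] := ubnP #|V|; elim: m => // m IHm in V l L * => leVm V13 lK l3 bigL.
move: L bigL; apply: (small_pot c0) => L bigL pot.
have [[p /andP[Qp /set0Pn[c /bigcapP cF]]]|/existsPn com0] := altP (@existsP P (fun p =>
    (p \in parts_of_size V 3) && (\bigcap_(v in fibre V p) L v != set0))); last first.
  apply: (@merging_colourable _ _ l) => // p Qp; apply/eqP.
  by have := com0 p; rewrite Qp negbK.
pose V' := V :\: fibre V p.
have p3 : #|fibre V p| = 3 by move: Qp; rewrite inE => /eqP.
have V'p q : fibre V' q = if q == p then set0 else fibre V q.
  case: eqP => [->|/eqP nqp]; apply/setP=> v; rewrite !inE.
    by case: (v \in V); case: (part v == p).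
  by case: (v \in V); rewrite ?andbF //; case: (part v =P q) => [->|]; rewrite ?andbF // nqp.
have e3 : parts_of_size V' 3 = parts_of_size V 3 :\ p.
  by apply/setP=> q; rewrite !inE V'p; case: (q == p); rewrite ?cards0.
have e1 : parts_of_size V' 1 = parts_of_size V 1.
  by apply/setP=> q; rewrite !inE V'p; case: (q =P p) => // ->; rewrite cards0 p3.
have c3 := cardsD1 p (parts_of_size V 3); rewrite Qp in c3.
(* The common colour [c] is spent on the whole of [p]: [4 k + 2 s] falls by 4 and [3 l + 1] by only
   3. *)
have [||||| d dL dI] := IHm V' l.-1 (fun v => L v :\ c).
- have := subset_leq_card (subsetDl V (fibre V p)); rewrite -/V'.
  have : #|V'| < #|V|; last by lia.
  rewrite cardsD (setIidPr _) ?p3; last by apply/subsetP=> v; rewrite inE => /andP[].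
  have : fibre V p \subset V by apply/subsetP=> v; rewrite inE => /andP[].
  by move/subset_leq_card; rewrite p3; lia.
- by move=> q; rewrite V'p; case: (q == p) (V13 q); rewrite ?cards0.
- by rewrite e3 e1; lia.
- by rewrite e3 e1; lia.
- move=> v /setDP[Vv _]; have := bigL v Vv; have := cardsD1 c (L v).
  by case: (c \in _); lia.
exists (fun v => if part v == p then c else d v) => [v Vv|u v Vu Vv].
  case: eqP => [vp|/eqP nvp]; first by apply: cF; rewrite inE Vv vp /=.
  by have /setD1P[] : d v \in L v :\ c by apply: dL; rewrite !inE Vv nvp.
have dc w : w \in V -> part w != p -> d w != c.
  by move=> Vw nw; have /setD1P[] : d w \in L w :\ c by apply: dL; rewrite !inE Vw nw.
case: (eqVneq (part u) p) => [->|nu]; case: (eqVneq (part v) p) => [->|nv] //.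
- by move=> e; have := dc v Vv nv; rewrite -e eqxx.
- by move=> e; have := dc u Vu nu; rewrite e eqxx.
- by apply: dI; rewrite !inE ?Vu ?Vv ?nu ?nv.
Qed.

End Ohba.

(** * The Alon-Tarsi theorem *)

Section AlonTarsi.
Local Open Scope ring_scope.

(** The weights extract the coefficient of degree [d] from polynomials of degree at most [d]; they
    solve a Vandermonde system on [d + 1] nodes indexed by elements of [A]. *)
Lemma moment_weights (F : fieldType) (C : finType) (x : C -> F) (A : {set C}) (d : nat) :
    injective x -> (d < #|A|)%N ->
  exists w : C -> F, (forall c, c \notin A -> w c = 0) /\
    forall m, (m <= d)%N -> \sum_c w c * x c ^+ m = (m == d)%:R.
Proof.
move=> xI ltdA.
have [|B [_ sBA cB]] := @interpolate_subset _ set0 A d.+1 (sub0set _); first by rewrite cards0.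
have ltdB : (d < #|B|)%N by rewrite cB.
pose a : 'rV[F]_#|B| := \row_j x (enum_val j).
have unitV : Vandermonde #|B| a \in unitmx.
  rewrite unitmxE det_Vandermonde unitfE.
  apply/prodf_neq0 => i _; apply/prodf_neq0 => j ltij; rewrite !mxE subr_eq0 (inj_eq xI).
  by rewrite (inj_eq enum_val_inj) -(inj_eq val_inj) eq_sym; case: ltngtP ltij.
pose w0 : 'cV_#|B| := invmx (Vandermonde #|B| a) *m delta_mx (Ordinal ltdB) 0.
exists (fun c => \sum_(j | enum_val j == c) w0 j 0); split=> [c nAc|m lemd].
  apply: big1 => j /eqP ej; case/negP: nAc; rewrite -ej.
  exact: (subsetP sBA) (enum_valP j).
have ltmB : (m < #|B|)%N by rewrite cB.
transitivity ((Vandermonde #|B| a *m w0) (Ordinal ltmB) 0); last first.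
  by rewrite mulKVmx // mxE eqxx andbT -(inj_eq val_inj).
rewrite mxE (eq_bigr (fun j => w0 j 0 * x (enum_val j) ^+ m)); last first.
  by move=> j _; rewrite !mxE mulrC.
rewrite (partition_big (fun j : 'I_#|B| => enum_val j) predT) //=; apply: eq_bigr => c _.
by rewrite mulr_suml; apply: eq_bigr => j /eqP->.
Qed.

Definition incr (I : eqType) (i : I) (a : I -> nat) v := (a v + (v == i))%N.

(* The coefficient of [\prod_v X_v ^+ d v] in
   [\prod_v X_v ^+ a v * \prod_((i, j) <- E) (X_i - X_j)], for [a <= d]. *)
Fixpoint graph_coef (I : eqType) (d : I -> nat) (E : seq (I * I)) (a : I -> nat) : int :=
  if E is (i, j) :: E' then
    (if (a i < d i)%N then graph_coef d E' (incr i a) else 0) -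
    (if (a j < d j)%N then graph_coef d E' (incr j a) else 0)
  else 1.

(** Lets a coefficient be computed on [nat] and used for a graph on ordinals. *)
Lemma graph_coef_map (I J : eqType) (h : I -> J) d d' E a a' : injective h ->
    (forall v, d' (h v) = d v) -> (forall v, a' (h v) = a v) ->
  graph_coef d' [seq (h e.1, h e.2) | e <- E] a' = graph_coef d E a.
Proof.
move=> hI hd; elim: E a a' => //= -[i j] E IHE a a' ha /=.
rewrite !ha !hd (IHE (incr i a)) ?(IHE (incr j a)) // => v.
all: by rewrite /incr ha (inj_eq hI).
Qed.

Section Functional.
Variables (R : numFieldType) (I C : finType) (x : C -> R) (w : I -> C -> R) (d : I -> nat).
Hypothesis wP : forall i m, (m <= d i)%N -> \sum_c w i c * x c ^+ m = (m == d i)%:R.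

(** The product of the one-variable functionals. In total degree [\sum_v d v] it extracts the
    coefficient of [\prod_v X_v ^+ d v], as shown below. *)
Let Lam (F : {ffun I -> C} -> R) := \sum_(f : {ffun I -> C}) (\prod_i w i (f i)) * F f.
Let mono (a : I -> nat) (f : {ffun I -> C}) := \prod_i x (f i) ^+ a i.
Let disc (E : seq (I * I)) (f : {ffun I -> C}) := \prod_(e <- E) (x (f e.1) - x (f e.2)).

Let Lam_mono a : Lam (mono a) = \prod_i \sum_c w i c * x c ^+ a i.
Proof. by rewrite bigA_distr_bigA; apply: eq_bigr => f _; rewrite -big_split. Qed.

Let mono_incr i a f : mono (incr i a) f = mono a f * x (f i).
Proof.
rewrite /mono /incr (eq_bigr (fun v => x (f v) ^+ a v * x (f v) ^+ (v == i))); last first.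
  by move=> v _; rewrite exprD.
rewrite big_split /= [X in _ * X](bigD1 i) //= eqxx expr1 [\prod_(v | v != i) _]big1 ?mulr1 // => v /negPf->.
by rewrite expr0.
Qed.

Let Lam_cons i j E a : Lam (fun f => mono a f * disc ((i, j) :: E) f) =
  Lam (fun f => mono (incr i a) f * disc E f) - Lam (fun f => mono (incr j a) f * disc E f).
Proof.
rewrite /Lam -sumrB; apply: eq_bigr => f _; rewrite !mono_incr /disc big_cons /=.
by rewrite -mulrBr; congr (_ * _); rewrite mulrA mulrBr mulrBl.
Qed.

Let sum_incr (i : I) a : (\sum_v incr i a v = (\sum_v a v).+1)%N.
Proof.
rewrite big_split /= [X in (_ + X)%N](bigD1 i) //= eqxx [(\sum_(v | v != i) _)%N]big1 ?addn1 // => v /negPf->.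
by [].
Qed.

(** [wP] is silent on exponents above [d]. In total degree [\sum_v d v], a monomial too large at [i]
    is too small at some [j], where its factor vanishes; this justifies the truncation in
    [graph_coef]. *)
Let Lam_vanish E a i : (\sum_v a v + size E = \sum_v d v)%N -> (d i < a i)%N ->
  Lam (fun f => mono a f * disc E f) = 0.
Proof.
elim: E a => [|[u v] E IHE] a /= sumE lti; last first.
  by rewrite Lam_cons !IHE ?subr0 ?sum_incr -?sumE ?addnS // /incr ltn_addr.
transitivity (Lam (mono a)).
  by apply: eq_bigr => f _; rewrite /disc big_nil mulr1.
have [j ltj] : exists j, (a j < d j)%N.
  apply/existsP; apply: contraTT lti => /existsPn le; rewrite -leqNgt.
  have le' v : (d v <= a v)%N by rewrite leqNgt le.
  move: sumE; rewrite addn0 (bigD1 i) //= [RHS](bigD1 i) //= => e.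
  have : (\sum_(v | v != i) d v <= \sum_(v | v != i) a v)%N by apply: leq_sum.
  by lia.
rewrite Lam_mono (bigD1 j) //= wP; last exact: ltnW.
by case: ltngtP ltj; rewrite // mul0r.
Qed.

Lemma functional_graph_coef E a : (forall v, a v <= d v)%N ->
    (\sum_v a v + size E = \sum_v d v)%N ->
  Lam (fun f => mono a f * disc E f) = (graph_coef d E a)%:~R.
Proof.
elim: E a => [|[i j] E IHE] a leq sumE /=.
  transitivity (Lam (mono a)).
    by apply: eq_bigr => f _; rewrite /disc big_nil mulr1.
  have ead v : a v = d v.
    move: sumE; rewrite addn0 (bigD1 v) //= [RHS](bigD1 v) //= => e.
    have : (\sum_(u | u != v) a u <= \sum_(u | u != v) d u)%N by apply: leq_sum.
    by have := leq v; lia.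
  by rewrite Lam_mono; apply: big1 => v _; rewrite wP ead ?eqxx.
have step u : Lam (fun f => mono (incr u a) f * disc E f) =
    (if (a u < d u)%N then graph_coef d E (incr u a) else 0)%:~R.
  case: ifPn => ltu.
    apply: IHE; last by rewrite sum_incr -sumE addnS.
    by move=> v; rewrite /incr; case: eqP => [->|_]; rewrite ?addn1 ?addn0.
  apply: (@Lam_vanish _ _ u); first by rewrite sum_incr -sumE addnS.
  by rewrite /incr eqxx addn1 ltnS leqNgt.
by rewrite Lam_cons !step intrB.
Qed.

End Functional.

(** The coefficient is a weighted sum of values of the graph polynomial, so some term is nonzero:
    its weights put [f] in the lists, and its polynomial value makes [f] proper. *)
Theorem Alon_Tarsi (I C : finType) (L : I -> {set C}) (d : I -> nat) (E : seq (I * I)) :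
    (\sum_v d v = size E)%N -> graph_coef d E (fun=> 0%N) != 0 ->
    (forall i, d i < #|L i|)%N ->
  exists2 f : I -> C, forall i, f i \in L i & {in E, forall e, f e.1 != f e.2}.
Proof.
move=> sumE coef0 ltL.
pose x (c : C) : rat := (enum_rank c)%:R.
have xI : injective x.
  by move=> b c /eqP; rewrite eqr_nat => /eqP/val_inj/enum_rank_inj.
have [w wP] := fin_all_exists (fun i => moment_weights xI (ltL i)).
have wm i m : (m <= d i)%N -> \sum_c w i c * x c ^+ m = (m == d i)%:R.
  by case: (wP i) => _; apply.
have := functional_graph_coef wm (E := E) (a := fun=> 0%N) (fun=> leq0n _).
rewrite sum_nat_const muln0 add0n -sumE => /(_ erefl) LamE.
have /existsP[f] : [exists f : {ffun I -> C}, (\prod_i w i (f i)) * (\prod_i x (f i) ^+ 0 *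
    \prod_(e <- E) (x (f e.1) - x (f e.2))) != 0].
  apply: contraNT coef0 => /existsPn f0; rewrite -(intr_eq0 rat) -LamE.
  by apply/eqP/big1 => f _; apply/eqP; rewrite -[_ == _]negbK f0.
rewrite !mulf_eq0 !negb_or => /and3P[/prodf_neq0 wf _].
rewrite prodf_seq_neq0 => /allP xf.
exists f => [i|e Ee].
  by apply: contraT => nL; have := wf i isT; case: (wP i) => -> //; rewrite eqxx.
by have /= := xf e Ee; rewrite subr_eq0 (inj_eq xI).
Qed.

End AlonTarsi.

(** The edges of the complement of the square of [C_n], each listed once with the smaller index
    first. *)
Definition far_pairs n := [seq e <- [seq (i, j) | i <- iota 0 n, j <- iota 0 n] |
   (e.1 + 3 <= e.2) && (e.2 + 3 <= n + e.1)].
(* Exponents, at most 2, of a monomial with nonzero coefficient (for [n = 9] it is -18). *)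
Definition far_degrees n : nat -> nat :=
  match n with
  | 7 => nth 0 [:: 0; 0; 0; 1; 2; 2; 2]
  | 8 => nth 0 [:: 0; 0; 2; 2; 2; 2; 2; 2]
  | _ => fun=> 2
  end.

Lemma far_coef n : n \in [:: 7; 8; 9] ->
  [&& (graph_coef (far_degrees n) (far_pairs n) (fun=> 0) != 0),
      sumn [seq far_degrees n i | i <- iota 0 n] == size (far_pairs n)
    & all (geq 2 \o far_degrees n) (iota 0 n)].
Proof.
by rewrite !inE => /or3P[] /eqP->; vm_compute.
Qed.

(** * Wheels *)

(** Cuts a possibly infinite list down to [r] colours. *)
Lemma card_le_seq r (A : set nat) : (`I_r #<= A)%card ->
  exists s : seq nat, [/\ uniq s, size s = r & forall x, x \in s -> A x].
Proof.
move=> /pcard_leP[f]; exists [seq f i | i <- iota 0 r]; split.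
- rewrite map_inj_in_uniq ?iota_uniq // => x y.
  rewrite !mem_iota !add0n /= => xr yr e.
  by apply: (@inj _ _ _ f) e; apply: mem_set.
- by rewrite size_map size_iota.
- by move=> _ /mapP[x xr ->]; apply: funS; move: xr; rewrite mem_iota.
Qed.

Section Geodesics.
Variables (T : finType) (e : rel T).
Implicit Types (x y m : T).

Lemma geodesic_refl x : is_geodesic e x x [::].
Proof. by split. Qed.

Lemma geodesic_edge x y : x != y -> e x y -> is_geodesic e x y [:: y].
Proof.
move=> nxy exy; split; first by split; rewrite /= ?exy // inE nxy.
by case=> [[_ _ /= exy']|//]; rewrite exy' eqxx in nxy.
Qed.

Lemma geodesic_two x m y : uniq [:: x; m; y] -> ~~ e x y -> e x m -> e m y ->
  is_geodesic e x y [:: m; y].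
Proof.
move=> uxmy nexy exm emy; split; first by split; rewrite //= exm emy.
move=> [|a [|b q]] // [/= pq _ lq].
  by move: uxmy; rewrite lq /= !inE eqxx orbT.
by rewrite andbT lq (negPf nexy) in pq.
Qed.

Lemma mem_edges x y : e x y -> [set x; y]%SET \in edges e.
Proof. by move=> exy; apply/imset2P; exists x y; rewrite ?inE. Qed.

Lemma rainbow_two_colours c x y : strongly_rainbow_connected e c -> x != y -> ~~ e x y ->
  exists E1 E2, [/\ E1 \in edges e, E2 \in edges e & c E1 != c E2].
Proof.
move=> /(_ x y)[[|m [|m' q]] [[/= pq uq lq] _] rb] nxy nexy.
- by rewrite lq eqxx in nxy.
- by rewrite lq (negPf nexy) in pq.
case/and3P: pq => exm emm' _; exists [set x; m]%SET, [set m; m']%SET.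
split; try exact: mem_edges.
by move: rb; rewrite /rainbow /= inE negb_or => /andP[/andP[]].
Qed.

End Geodesics.

(** Constant lists [0, ..., r - 1] reduce lower bounds to colourings with [r] colours. *)
Lemma list_src_at_lt (T : finType) (e : rel T) r : list_src_at e r ->
  exists2 c : {set T} -> nat, {in edges e, forall E, c E < r} & strongly_rainbow_connected e c.
Proof.
move=> /(_ (fun=> `I_r)) [E _|c cL cS]; first exact: card_lexx.
by exists c => // E /cL.
Qed.

(** * Rainbow geodesics in wheels and lower bounds *)

Section Wheel.
Variable n : nat.
Implicit Types i j : 'I_n.

Definition spoke i : {set option 'I_n} := [set None; Some i]%SET.
Definition rim i : {set option 'I_n} := [set Some i; Some (ordS i)]%SET.
(** Cyclic distance at least 3, in the form that excludes rim paths with at most two edges. *)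
Definition far i j :=
  [&& i != j, ~~ cycle_graph i j, ordS (ordS i) != j & ordS (ordS j) != i].

Lemma val_ordS i : ordS i = (if i.+1 == n then 0 else i.+1) :> nat.
Proof.
rewrite /=; case: eqP => [->|/eqP ne]; first by rewrite modnn.
by rewrite modn_small // ltn_neqAle ne ltn_ord.
Qed.

Lemma cycle_graphE i j : cycle_graph i j =
  [|| i.+1 == j, j.+1 == i, (i.+1 == n) && (j == 0 :> nat) | (j.+1 == n) && (i == 0 :> nat)].
Proof.
rewrite /cycle_graph -!(inj_eq (@ord_inj n)) !val_ordS.
have := ltn_ord i; have := ltn_ord j; move: (nat_of_ord i) (nat_of_ord j) => {}i {}j ltj lti.
by case: (i.+1 =P n); case: (j.+1 =P n); lia.
Qed.

Lemma farE i j : far i j =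
  (i + 3 <= j) && (j + 3 <= n + i) || (j + 3 <= i) && (i + 3 <= n + j).
Proof.
rewrite /far cycle_graphE -!(inj_eq (@ord_inj n)) !val_ordS.
have := ltn_ord i; have := ltn_ord j; move: (nat_of_ord i) (nat_of_ord j) => {}i {}j ltj lti.
by case: (i.+1 =P n); case: (j.+1 =P n) => ? ?; do 2?case: ifPn; lia.
Qed.

Lemma spoke_edge i : spoke i \in edges (wheel n).
Proof. exact: mem_edges. Qed.

Lemma rim_edge i : rim i \in edges (wheel n).
Proof. by apply: mem_edges; rewrite /= /cycle_graph eqxx. Qed.

Lemma wheel_edgeP E : E \in edges (wheel n) ->
  (exists i, E = spoke i) \/ (exists i, E = rim i).
Proof.
case/imset2P=> -[i|] [j|] _; rewrite inE //= => eij ->.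
- case/orP: eij => /eqP<-; right; first by exists i.
  by exists j; rewrite /rim setUC.
- by left; exists i; rewrite /spoke setUC.
- by left; exists j.
Qed.

Definition wheel_colouring (s t : 'I_n -> nat) (E : {set option 'I_n}) : nat :=
  if [pick i | E == spoke i] is Some i then s i else
  if [pick i | E == rim i] is Some i then t i else 0.

Lemma wheel_colouring_spoke s t i : wheel_colouring s t (spoke i) = s i.
Proof.
rewrite /wheel_colouring; case: pickP => [j|/(_ i)]; last by rewrite eqxx.
move=> /eqP/setP/(_ (Some i)); rewrite !inE /= eqxx.
by case: eqP => // -[->].
Qed.

(** For [n = 2] both rim indices would name the same edge. *)
Lemma wheel_colouring_rim s t i : 2 < n -> wheel_colouring s t (rim i) = t i.
Proof.
move=> n3; rewrite /wheel_colouring; case: pickP => [j|_].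
  by move=> /eqP/setP/(_ None); rewrite !inE.
case: pickP => [j|/(_ i)]; last by rewrite eqxx.
move=> /eqP eij; congr t; apply/eqP.
move/setP/(_ (Some i)): (eij); move/setP/(_ (Some j)): (eij).
move/setP/(_ (Some (ordS i))): eij; rewrite !inE !eqxx /= !orbT.
rewrite !(inj_eq Some_inj) -!(inj_eq (@ord_inj n)) !val_ordS.
have := ltn_ord i; have := ltn_ord j; move: (nat_of_ord i) (nat_of_ord j) => {}i {}j.
by case: (i.+1 =P n); case: (j.+1 =P n); lia.
Qed.

(** Nonadjacent rim vertices with a common rim neighbour have a geodesic through it and one through
    the hub; either may be the rainbow one. In [C_3] the vertices [i] and [ordS (ordS i)] are
    adjacent, hence the guard. *)
Lemma strongly_rainbow_wheel (c : {set option 'I_n} -> nat) : 2 < n ->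
    (forall i j, far i j -> c (spoke i) != c (spoke j)) ->
    (forall i, ~~ cycle_graph i (ordS (ordS i)) ->
       (c (rim i) != c (rim (ordS i))) || (c (spoke i) != c (spoke (ordS (ordS i))))) ->
  strongly_rainbow_connected (wheel n) c.
Proof.
move=> n3 cfar cnear u v.
have [->|nuv] := eqVneq u v; first by exists [::] => //; apply: geodesic_refl.
have [euv|neuv] := boolP (wheel n u v).
  by exists [:: v]; [apply: geodesic_edge | rewrite /rainbow].
case: u v nuv neuv => [i|] [j|] //= nij neij.
have hub : c (spoke i) != c (spoke j) ->
    exists2 p, is_geodesic (wheel n) (Some i) (Some j) p & rainbow c (Some i) p.
  move=> nc; exists [:: None; Some j]; first by apply: geodesic_two; rewrite //= !inE nij.
  by rewrite /rainbow /= inE andbT setUC.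
have n2 : 1 < n by lia.
have outer k : cycle_graph i k -> cycle_graph k j ->
    c [set Some i; Some k]%SET != c [set Some k; Some j]%SET ->
    exists2 p, is_geodesic (wheel n) (Some i) (Some j) p & rainbow c (Some i) p.
  move=> eik ekj nc; exists [:: Some k; Some j]; last by rewrite /rainbow /= inE andbT.
  apply: geodesic_two => //=; rewrite !inE negb_or nij !andbT.
  by apply/andP; split; apply/eqP => -[e]; [move: eik | move: ekj];
     rewrite e; have /= -> := wheel_irr n2 (Some _).
have next k : cycle_graph k (ordS k) by rewrite /cycle_graph eqxx.
have prev k : cycle_graph (ordS k) k by rewrite /cycle_graph eqxx orbT.
have [farij|] := boolP (far i j); first exact/hub/cfar.
rewrite /far neij /= !negb_and !negbK (inj_eq Some_inj) in nij *.
rewrite (negPf nij) /= => /orP[] /eqP e; [have := cnear i | have := cnear j]; rewrite e.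
  case/(_ neij)/orP=> [nc|]; last exact: hub.
  by apply: (outer (ordS i)) => //; rewrite -e.
rewrite /cycle_graph orbC -/(cycle_graph i j).
case/(_ neij)/orP=> [nc|]; last by rewrite eq_sym; apply: hub.
apply: (outer (ordS j)); rewrite -?e //.
by rewrite eq_sym [X in c X != _]setUC [X in _ != c X]setUC.
Qed.

(** The path through the hub bounds geodesics by two edges, and [far] rules out a middle vertex on
    the rim. *)
Lemma rainbow_far_spokes (c : {set option 'I_n} -> nat) i j :
  strongly_rainbow_connected (wheel n) c -> far i j -> c (spoke i) != c (spoke j).
Proof.
move=> /(_ (Some i) (Some j))[p [[pp up lp] minp] rb] /and4P[nij neij nij2 nji2].
have : size p <= 2.
  by apply: (minp [:: None; Some j]); split; rewrite //= !inE (inj_eq Some_inj) nij.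
case: p pp up lp rb {minp} => [|u [|v [|//]]] /=.
- by move=> _ _ [e]; rewrite e eqxx in nij.
- by move=> eij _ e; move: eij; rewrite e /= (negPf neij).
move=> puv _ e; rewrite {v}e in puv *; case: u puv => [k|_].
  rewrite /= andbT /cycle_graph => /andP[/orP[] /eqP e1 /orP[] /eqP e2] _ _.
  + by rewrite -e2 -e1 eqxx in nij2.
  + by move: nij; rewrite (bij_inj (ordS_bij _) (etrans e1 (esym e2))) eqxx.
  + by rewrite -e1 -e2 eqxx in nij.
  + by rewrite -e1 -e2 eqxx in nji2.
by rewrite /rainbow /= inE andbT setUC.
Qed.

(** Among four such vertices in cyclic order, the two opposite pairs force three consecutive gaps
    equal to 1; the ends of this stretch are far, since [n - 3 >= 3]. *)
Lemma card_pairwise_near (F : {set 'I_n}) : 7 <= n ->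
  {in F &, forall i j, ~~ far i j} -> #|F| <= 3.
Proof.
move=> n7 nearF; rewrite leqNgt; apply/negP.
have srt : sorted ltn [seq val i | i <- enum F].
  rewrite /enum_mem -enumT /=; apply: (subseq_sorted ltn_trans _ (iota_ltn_sorted 0 n)).
  by rewrite -val_enum_ord; apply: map_subseq; apply: filter_subseq.
have inF i : i \in enum F -> i \in F by rewrite mem_enum.
rewrite cardE; case: (enum F) srt inF => [|a [|b [|c [|d q]]]] //= srt inF _.
have far' i j : i \in [:: a; b; c; d] -> j \in [:: a; b; c; d] -> ~~ far i j.
  by move=> hi hj; apply: nearF; apply: inF; rewrite -[_ :: _]/([:: a; b; c; d] ++ q) mem_cat ?hi ?hj.
case/and4P: srt => ab bc cd _.
have := ltn_ord d; move: ab bc cd n7.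
have := far' a b; have := far' a c; have := far' a d; have := far' b c.
have := far' b d; have := far' c d; rewrite !farE !inE !eqxx /= ?orbT.
move: (nat_of_ord a) (nat_of_ord b) (nat_of_ord c) (nat_of_ord d).
move=> {inF far'} {}a {}b {}c {}d h1 h2 h3 h4 h5 h6.
have {}h1 := h1 isT isT; have {}h2 := h2 isT isT; have {}h3 := h3 isT isT.
have {}h4 := h4 isT isT; have {}h5 := h5 isT isT; have {}h6 := h6 isT isT.
lia.
Qed.

Lemma list_src_wheel_ge r : 7 <= n -> list_src_at (wheel n) r -> n <= 3 * r.
Proof.
move=> n7 /list_src_at_lt[c cr cS].
pose s i := Ordinal (cr _ (spoke_edge i)).
rewrite -[leqLHS]card_ord -sum1_card (partition_big s predT) //=.
rewrite mulnC -[X in _ <= X * 3]card_ord -sum_nat_const; apply: leq_sum => a _.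
rewrite sum1dep_card; apply: card_pairwise_near => // i j.
rewrite !inE => /eqP si /eqP sj; apply/negP => /(rainbow_far_spokes cS).
by have := congr1 val (etrans si (esym sj)) => /= ->; rewrite eqxx.
Qed.

Lemma list_src_wheel_gt0 r : 0 < n -> list_src_at (wheel n) r -> 0 < r.
Proof.
move=> n0 /list_src_at_lt[c cr _].
by have := cr _ (spoke_edge (Ordinal n0)); lia.
Qed.

Lemma list_src_wheel_gt1 r : 3 < n -> list_src_at (wheel n) r -> 1 < r.
Proof.
move=> n4 /list_src_at_lt[c cr cS].
have n0 : 0 < n by lia. have n2 : 2 < n by lia.
(* The rim vertices 0 and 2 are not adjacent, so a rainbow path between them shows two colours. *)
have [||E1 [E2 [/cr c1 /cr c2]]] := @rainbow_two_colours _ _ c (Some (Ordinal n0)) (Some (Ordinal n2)) cS.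
- by [].
- by rewrite /= cycle_graphE /=; lia.
- lia.
Qed.

Lemma list_src_wheel_at r : 2 < n ->
    (forall Ls Lt : 'I_n -> seq nat, (forall i, uniq (Ls i) /\ size (Ls i) = r) ->
        (forall i, uniq (Lt i) /\ size (Lt i) = r) ->
      exists s t : 'I_n -> nat, [/\ forall i, s i \in Ls i, forall i, t i \in Lt i,
        forall i j, far i j -> s i != s j
        & forall i, ~~ cycle_graph i (ordS (ordS i)) ->
            (t i != t (ordS i)) || (s i != s (ordS (ordS i)))]) ->
  list_src_at (wheel n) r.
Proof.
move=> n3 choose L bigL.
have [Ls LsP] := fin_all_exists (fun i => card_le_seq (bigL _ (spoke_edge i))).
have [Lt LtP] := fin_all_exists (fun i => card_le_seq (bigL _ (rim_edge i))).
have [||s [t [sL tL sfar near]]] := choose Ls Lt.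
- by move=> i; case: (LsP i).
- by move=> i; case: (LtP i).
exists (wheel_colouring s t).
  move=> E /wheel_edgeP[] [i ->].
    by rewrite wheel_colouring_spoke; case: (LsP i) => _ _; apply.
  by rewrite wheel_colouring_rim //; case: (LtP i) => _ _; apply.
apply: strongly_rainbow_wheel => // [i j|i]; rewrite !wheel_colouring_spoke; first exact: sfar.
by rewrite !wheel_colouring_rim //; apply: near.
Qed.

End Wheel.

(** * Greedy list colourings *)

Definition avoid (s X : seq nat) := head 0 [seq x <- s | x \notin X].

(** A duplicate-free [s] longer than [X] is not contained in [X], so the default 0 of [avoid] is not
    reached. *)
Lemma avoidP s X : uniq s -> size X < size s -> avoid s X \in s /\ avoid s X \notin X.
Proof.
move=> us ltX; rewrite /avoid; case e: [seq x <- s | x \notin X] => [|x q] /=.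
  suff /(uniq_leq_size us) : {subset s <= X} by rewrite leqNgt ltX.
  by move=> x sx; apply: contraT => nXx; have := in_nil x; rewrite -e mem_filter nXx sx.
by have := mem_head x q; rewrite -e mem_filter => /andP[].
Qed.

(** Colours a path in order. [X] is forbidden at every index but 0, which allows a path to be closed
    into a cycle. *)
Fixpoint greedy (l : nat -> seq nat) (X : seq nat) k :=
  if k is k'.+1 then avoid (l k) (greedy l X k' :: X) else avoid (l 0) [::].

Section Greedy.
Variables (l : nat -> seq nat) (X : seq nat) (r : nat).
Hypothesis lP : forall k, uniq (l k) /\ size (l k) = r.
Hypothesis rX : (size X).+1 < r.

Lemma greedy_mem k : greedy l X k \in l k.
Proof.
case: k => [|k] /=; [have [u sz] := lP 0 | have [u sz] := lP k.+1].
  by case: (@avoidP (l 0) [::] u) => //; rewrite sz /=; lia.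
by case: (@avoidP (l k.+1) (greedy l X k :: X) u) => //; rewrite sz /=; lia.
Qed.

Lemma greedy_neq k : greedy l X k.+1 != greedy l X k /\ greedy l X k.+1 \notin X.
Proof.
have [u sz] := lP k.+1; case: (@avoidP _ (greedy l X k :: X) u); first by rewrite sz.
by rewrite inE negb_or => _ /andP[].
Qed.

End Greedy.

(** * Upper bounds from list colourings of spokes and rim *)

Section Choosability.
Variable n' : nat.
Local Notation n := n'.+1.

Lemma far_neq_of_lt (X : eqType) (f : 'I_n -> X) :
  (forall i j : 'I_n, i < j -> far i j -> f i != f j) -> forall i j, far i j -> f i != f j.
Proof.
move=> flt i j fij; have [lt|lt|e] := ltngtP i j; first exact: flt.
  by rewrite eq_sym; apply: flt => //; move: fij; rewrite !farE orbC.
by move: fij; rewrite farE e; lia.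
Qed.

Lemma rim_colouring r (Lt : 'I_n -> seq nat) : 2 < r -> 1 < n ->
    (forall i, uniq (Lt i) /\ size (Lt i) = r) ->
  exists2 t : 'I_n -> nat, forall i, t i \in Lt i & forall i, t i != t (ordS i).
Proof.
move=> r3 n2 LtP; pose l k := Lt (inord k).
have lP k : uniq (l k) /\ size (l k) = r by apply: LtP.
(* This is the colour of rim edge 0; forbidding it afterwards makes the last rim edge differ from
   the first. *)
pose X := [:: avoid (l 0) [::]].
exists (fun i => greedy l X i) => i.
  by have := greedy_mem (X := X) lP r3 i; rewrite /l inord_val.
rewrite val_ordS; case: (i.+1 =P n) => [e|_]; last by rewrite eq_sym; case: (greedy_neq (X := X) lP r3 i).
case: (nat_of_ord i) e => [|k] e; first by lia.
by have [_] := greedy_neq (X := X) lP r3 k; rewrite inE.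
Qed.

(** The lists are finite, so their colours are bounded and embed in a finite type, as the
    choosability theorems require. *)
Lemma spoke_colouring_of_sets r (Ls : 'I_n -> seq nat) :
    (forall (C : finType) (c0 : C) (L : 'I_n -> {set C}), (forall i, r <= #|L i|) ->
      exists2 f : 'I_n -> C, forall i, f i \in L i & forall i j, far i j -> f i != f j) ->
    (forall i, uniq (Ls i) /\ size (Ls i) = r) ->
  exists2 s : 'I_n -> nat, forall i, s i \in Ls i & forall i j, far i j -> s i != s j.
Proof.
move=> choose LsP; pose N := \max_i \max_(x <- Ls i) x.
have ltN i x : x \in Ls i -> x < N.+1.
  move=> Lx; rewrite ltnS (leq_trans _ (leq_bigmax i)) //.
  by apply: leq_bigmax_seq.
have [|f fL ff] := choose _ (ord0 : 'I_N.+1) (fun i => [set c : 'I_N.+1 | val c \in Ls i]).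
  move=> i; have [u <-] := LsP i; rewrite cardE -(size_map val).
  apply: uniq_leq_size => // x Lx; apply/mapP; exists (Ordinal (ltN i x Lx)) => //.
  by rewrite mem_enum inE.
exists (fun i => val (f i)) => [i|i j /ff //].
by have := fL i; rewrite inE.
Qed.

(** Three colours per rim edge allow a proper colouring of the rim, odd or even, which leaves only
    far spokes to separate. *)
Lemma list_src_wheel_of_spokes r : 2 < n -> 2 < r ->
    (forall (C : finType) (c0 : C) (L : 'I_n -> {set C}), (forall i, r <= #|L i|) ->
      exists2 f : 'I_n -> C, forall i, f i \in L i & forall i j, far i j -> f i != f j) ->
  list_src_at (wheel n) r.
Proof.
move=> n3 r3 choose; apply: list_src_wheel_at => // Ls Lt LsP LtP.
have [s sL sf] := spoke_colouring_of_sets choose LsP.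
have [|t tL tn] := rim_colouring r3 _ LtP; first by lia.
by exists s, t; split=> // i _; rewrite tn.
Qed.

Lemma list_src_small_wheel : n \in [:: 4; 5; 6] -> list_src_at (wheel n) 2.
Proof.
move=> n456; apply: list_src_wheel_at => [|Ls Lt LsP LtP].
  by move: n456; rewrite !inE; lia.
pose l k := Ls (inord k); pose l' k := Lt (inord k).
have lP k : uniq (l k) /\ size (l k) = 2 by apply: LsP.
have l'P k : uniq (l' k) /\ size (l' k) = 2 by apply: LtP.
have av k X : size X < 2 -> avoid (l k) X \in l k /\ avoid (l k) X \notin X.
  by move=> X2; have [u sz] := lP k; apply: avoidP; rewrite ?sz.
(* Colouring the rim in order protects every vertex of the rim but 0, so the spokes must be
   distinct on [n.-1], 1 and, if [n = 6], on opposite vertices: these pairs form a forest. *)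
pose a0 := avoid (l 0) [::]; pose a1 := avoid (l 1) [::].
pose last := avoid (l n.-1) [:: a1].
pose s (k : nat) : nat := if k == n.-1 then last else
  match k with
  | 0 => a0
  | 1 => a1
  | 2 => avoid (l 2) [:: last]
  | 3 => avoid (l 3) [:: a0]
  | k => avoid (l k) [:: a1]
  end.
have sl k : s k \in l k.
  rewrite /s; case: eqP => [->|_]; first by case: (av n.-1 [:: a1]).
  case: k => [|[|[|[|k]]]]; first by case: (av 0 [::]).
  - by case: (av 1 [::]).
  - by case: (av 2 [:: last]).
  - by case: (av 3 [:: a0]).
  - by case: (av k.+4 [:: a1]).
have avn k a : avoid (l k) [:: a] != a by case: (av k [:: a]) => // _; rewrite inE.
exists (fun i => s i), (fun i => greedy l' [::] i); split.
- by move=> i; have := sl i; rewrite /l inord_val.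
- by move=> i; have := greedy_mem (X := [::]) l'P isT i; rewrite /l' inord_val.
- apply: far_neq_of_lt => i j; rewrite farE => ltij fij; have ltj := ltn_ord j.
  (* A far pair forces [n = 6], and there the far pairs are the opposite ones. *)
  have e5 : n.-1 = 5 by move: n456; rewrite !inE; lia.
  have -> : nat_of_ord j = i + 3 by lia.
  have : i < 3 by lia.
  rewrite /s /last e5; case: (nat_of_ord i) => [|[|[|]]] //= _.
  + by rewrite eq_sym avn.
  + by rewrite eq_sym avn.
move=> i _; rewrite !val_ordS; case: (i.+1 =P n) => [ei|_].
  rewrite orbC; apply/orP; left.
  have -> : (if 1 == n then 0 else 1) = 1 by case: (n') n456.
  have -> : nat_of_ord i = n.-1 by lia.
  rewrite /s eqxx ifF ?avn //.
  by move: n456; rewrite !inE; lia.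
by rewrite eq_sym; case: (greedy_neq (X := [::]) l'P isT i) => ->.
Qed.

Lemma far_pairsP (i j : 'I_n) : far i j -> i < j -> (val i, val j) \in far_pairs n.
Proof.
rewrite farE => fij lij; rewrite mem_filter; apply/andP; split; first by move: fij => /=; lia.
by apply/allpairsP; exists (val i, val j); split=> //; rewrite mem_iota ltn_ord.
Qed.

Lemma spokes_3_choosable (C : finType) (L : 'I_n -> {set C}) : n \in [:: 7; 8; 9] ->
    (forall i, 3 <= #|L i|) ->
  exists2 f : 'I_n -> C, forall i, f i \in L i & forall i j, far i j -> f i != f j.
Proof.
move=> n789 bigL; have /and3P[coef0 /eqP sumd /allP led] := far_coef n789.
pose E : seq ('I_n * 'I_n) := [seq (inord e.1, inord e.2) | e <- far_pairs n].
have valE : [seq (val e.1, val e.2) | e <- E] = far_pairs n.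
  rewrite -map_comp -[RHS]map_id; apply/eq_in_map => -[a b].
  rewrite mem_filter => /andP[_ /allpairsP[[a' b'] [+ + [-> ->]]]].
  by rewrite !mem_iota !add0n => /= lta ltb; rewrite !inordK.
have [||| f fL fE] := @Alon_Tarsi _ C L (fun i => far_degrees n i) E.
- by rewrite size_map -sumd sumnE big_map -(big_mkord predT (far_degrees n)) /index_iota subn0.
- move: coef0; rewrite -valE.
  by rewrite (graph_coef_map (d := fun i : 'I_n => far_degrees n i) (a := fun=> 0) _ val_inj).
- move=> i; apply: leq_ltn_trans (bigL i).
  by apply: (led i); rewrite mem_iota ltn_ord.
exists f => //; apply: far_neq_of_lt => u v ltuv fuv; have /= := fE (u, v); apply.
apply/mapP; exists (val u, val v); first exact: far_pairsP.
by rewrite /= !inord_val.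
Qed.

(** Consecutive triples get labels below [n %/ 3], and each of the [n %% 3] leftover vertices is its
    own label; labels in between have empty fibres. Far vertices get different labels. *)
Definition triple_part (i : 'I_n) : 'I_n :=
  inord (if i < 3 * (n %/ 3) then i %/ 3 else i).

Lemma card_ord_interval a b : #|[set p : 'I_n | a <= p < b]| <= b - a.
Proof.
rewrite cardE -(size_map val) -[leqRHS](size_iota a); apply: uniq_leq_size.
  by rewrite map_inj_uniq ?enum_uniq //; apply: val_inj.
by move=> _ /mapP[p + ->]; rewrite mem_enum inE mem_iota /=; lia.
Qed.

Lemma val_triple_part (i : 'I_n) :
  triple_part i = (if i < 3 * (n %/ 3) then i %/ 3 else i) :> nat.
Proof. by rewrite inordK //; have := ltn_ord i; case: ifP; lia. Qed.

Lemma spokes_choosable (C : finType) (c0 : C) (L : 'I_n -> {set C}) l :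
    n %/ 3 + n %% 3 <= l -> 4 * (n %/ 3) + 2 * (n %% 3) <= 3 * l + 1 ->
    (forall i, l <= #|L i|) ->
  exists2 f : 'I_n -> C, forall i, f i \in L i & forall i j, far i j -> f i != f j.
Proof.
move=> lK l3 bigL.
have small (p : 'I_n) : n %/ 3 <= p -> p < 3 * (n %/ 3) -> fibre triple_part [set: 'I_n] p = set0.
  move=> h1 h2; apply/setP=> i; rewrite !inE -(inj_eq (@ord_inj n)) val_triple_part.
  by have := ltn_ord i; case: ifP; lia.
have one (p : 'I_n) : 3 * (n %/ 3) <= p -> fibre triple_part [set: 'I_n] p = [set p].
  move=> h1; apply/setP=> i; rewrite !inE -!(inj_eq (@ord_inj n)) val_triple_part.
  by have := ltn_ord i; case: ifP; lia.
have three (p : 'I_n) : p < n %/ 3 -> #|fibre triple_part [set: 'I_n] p| = 3.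
  move=> h1; have hp : forall a, a < 3 -> 3 * p + a < n by move=> a; lia.
  have -> : fibre triple_part [set: 'I_n] p = inord (3 * p + 2) |: [set inord (3 * p); inord (3 * p + 1)].
    apply/setP=> i; rewrite !inE -!(inj_eq (@ord_inj n)) val_triple_part !inordK; try lia.
    by have := ltn_ord i; case: ifP; lia.
  rewrite cardsU1 cards2 !inE -!(inj_eq (@ord_inj n)) !inordK; lia.
have cases (p : 'I_n) : [\/ p < n %/ 3, n %/ 3 <= p < 3 * (n %/ 3) | 3 * (n %/ 3) <= p].
  have [h1|h1] := ltnP p (n %/ 3); first by constructor 1.
  by have [h2|h2] := ltnP p (3 * (n %/ 3)); [constructor 2 | constructor 3].
have V13 : parts_1_or_3 triple_part [set: 'I_n].
  move=> p; case: (cases p) => [h|/andP[h1 h2]|h]; first by rewrite three.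
    by rewrite small ?cards0.
  by rewrite one ?cards1.
have le3 : #|parts_of_size triple_part [set: 'I_n] 3| <= n %/ 3.
  rewrite -[leqRHS]subn0; apply: leq_trans (card_ord_interval _ _); apply: subset_leq_card.
  apply/subsetP=> p; rewrite !inE; case: (cases p) => [-> //|/andP[h1 h2]|h].
    by rewrite small ?cards0.
  by rewrite one ?cards1.
have le1 : #|parts_of_size triple_part [set: 'I_n] 1| <= n %% 3.
  have -> : n %% 3 = n - 3 * (n %/ 3) by lia.
  apply: leq_trans (card_ord_interval _ _); apply: subset_leq_card.
  apply/subsetP=> p; rewrite !inE ltn_ord andbT; case: (cases p) => [h|/andP[h1 h2]|-> //].
    by rewrite three.
  by rewrite small ?cards0.
have [|||f fL fI] := Ohba_choosable c0 (L := L) (l := l) V13.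
- lia.
- lia.
- by move=> i _; apply: bigL.
exists f => [i|i j fij]; first by apply: fL; rewrite inE.
apply/negP => /eqP /fI; rewrite !inE => /(_ isT isT) /(congr1 val) /=.
rewrite !val_triple_part; move: fij; rewrite farE.
by have := ltn_ord i; have := ltn_ord j; case: ifP; case: ifP; lia.
Qed.

End Choosability.

(** * The list strong rainbow connection number of wheels *)

Lemma list_src_exists (T : finType) (e : rel T) r :
  list_src_at e r -> exists2 r', is_list_src e r' & r' <= r.
Proof.
move=> er; have ex : exists r, `[< list_src_at e r >] by exists r; apply/asboolP.
case: (ex_minnP ex) => m /asboolP em minm; exists m; last exact/minm/asboolP.
by split=> // r' er'; apply/minm/asboolP.
Qed.

Theorem theorem3p8 (n : nat) (n_ge3 : 3 <= n) :
  [/\ n = 3 -> is_list_src (wheel n) 1,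
      n \in [:: 4; 5; 6] -> is_list_src (wheel n) 2,
      n \in [:: 7; 8; 9] -> is_list_src (wheel n) 3
    & 10 <= n ->
      exists2 r : nat, is_list_src (wheel n) r &
        [/\ (Num.ceil (n%:R / 3%:R : rat) <= r%:Z)%R,
            n %% 3 = 0 ->
              (r%:Z <= Num.ceil ((4%:R * n%:R - 3%:R) / 9%:R : rat))%R,
            n %% 3 = 1 ->
              (r%:Z <= Num.ceil ((4%:R * n%:R - 1) / 9%:R : rat))%R
          & n %% 3 = 2 ->
              (r%:Z <= Num.ceil ((4%:R * n%:R + 1) / 9%:R : rat))%R]].
Proof.
case: n n_ge3 => // n n3; split.
- move=> [en]; split; last by move=> r; apply: list_src_wheel_gt0.
  apply: list_src_wheel_at => // Ls Lt LsP LtP.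
  have memL (L : 'I_n.+1 -> seq nat) i : uniq (L i) /\ size (L i) = 1 -> head 0 (L i) \in L i.
    by case: (L i) => [[]|x q] //= _; rewrite mem_head.
  (* In [C_3] no two vertices are far and [i] is adjacent to [ordS (ordS i)], so any colours will
     do. *)
  exists (fun i => head 0 (Ls i)), (fun i => head 0 (Lt i)); split=> [i|i|i j|i].
  + exact: memL.
  + exact: memL.
  + by rewrite farE; have := ltn_ord i; have := ltn_ord j; lia.
  + rewrite cycle_graphE !val_ordS; have := ltn_ord i.
    by case: (i.+1 =P n.+1) => ? ?; do 2?case: ifPn; lia.
- move=> n456; split; first exact: list_src_small_wheel.
  by move=> r; apply: list_src_wheel_gt1; move: n456; rewrite !inE; lia.
- move=> n789; split.
    apply: list_src_wheel_of_spokes => // C _ L bigL; exact: spokes_3_choosable.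
  move=> r /list_src_wheel_ge; move: n789; rewrite !inE => h h'.
  by have := h' _; lia.
move=> n10.
(* The least [l] with [4 k + 2 s <= 3 l + 1], where [k = n.+1 %/ 3] and [s = n.+1 %% 3]. It is the
   ceiling of [(4 k + 2 s - 1) / 3], which for [s = 0, 1, 2] gives the three stated bounds. *)
pose l := (4 * (n.+1 %/ 3) + 2 * (n.+1 %% 3) + 1) %/ 3.
have : list_src_at (wheel n.+1) l.
  apply: list_src_wheel_of_spokes; [lia | rewrite /l; lia | move=> C c0 L bigL].
  by apply: (spokes_choosable c0 (l := l)) => //; rewrite /l; lia.
case/list_src_exists=> r rsrc lerl; exists r => //.
have ge : n.+1 <= 3 * r by case: rsrc => /list_src_wheel_ge + _; apply; lia.
(* For [r > 0], an upper bound by a ceiling becomes the strict inequality [r - 1 < x], from which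
   [bound] clears the denominator 9. *)
have ceil_ge (x : rat) : (r.-1%:R < x)%R -> (r%:Z <= Num.ceil x)%R.
  move=> lt; have -> : (r%:Z = r.-1%:Z + 1)%R by lia.
  by rewrite lezD1 ceil_gt_int.
have r0 : 0 < r by lia.
have rr : (r.-1%:R = r%:R - 1 :> rat)%R by rewrite -{2}(prednK r0) -natr1 addrK.
have bound (u v : nat) : (9 * r + u < 4 * n.+1 + v + 9) ->
    (9%:R * r%:R + u%:R < 4%:R * n.+1%:R + v%:R + 9%:R :> rat)%R.
  by move=> h; rewrite -!natrM -!natrD ltr_nat.
split=> [|n0|n1|n2].
- rewrite ceil_le_int ler_pdivrMr ?ltr0n // -natrM ler_nat; lia.
- apply: ceil_ge; rewrite ltr_pdivlMr ?ltr0n // rr.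
  have /bound : 9 * r + 3 < 4 * n.+1 + 0 + 9 by move: lerl; rewrite /l; lia.
  lra.
- apply: ceil_ge; rewrite ltr_pdivlMr ?ltr0n // rr.
  have /bound : 9 * r + 1 < 4 * n.+1 + 0 + 9 by move: lerl; rewrite /l; lia.
  lra.
- apply: ceil_ge; rewrite ltr_pdivlMr ?ltr0n // rr.
  have /bound : 9 * r + 0 < 4 * n.+1 + 1 + 9 by move: lerl; rewrite /l; lia.
  lra.
Qed.
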